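(* The set of (restrictions to $[a,b]$ of) polynomials is dense in $(\mathcal{LP}[a,b],\|\cdot\|_{[a,b]})$.
   Context: Laplace integral on $[a,b]$: with lower/upper Laplace derivates $\underline{LD}_1F(x)$, $\overline{LD}_1F(x)$ being the minimum of the $\liminf$'s, resp. maximum of the $\limsup$'s, as $s\to\infty$ of $s^2\int_0^\delta e^{-st}[F(x+t)-F(x)]dt$ and $(-s^2)\int_0^\delta e^{-st}[F(x-t)-F(x)]dt$ (one-sided at endpoints), a major function of $f$ is a continuous $U$ with $\underline{LD}_1U\geqslant f$, $\underline{LD}_1U>-\infty$ everywhere on $[a,b]$, a minor function a continuous $V$ with $\overline{LD}_1V\leqslant f$, $\overline{LD}_1V<\infty$ everywhere, and $f$ is Laplace integrable if $\sup_V(V(b)-V(a))=\inf_U(U(b)-U(a))$ is finite, this value being $\int_a^bf$. $\mathcal{LP}[a,b]$ is the space of Laplace integrable functions on $[a,b]$ modulo a.e. equality, with the Alexiewicz norm $\|f\|_{[a,b]}=\sup_{x\in[a,b]}\left|\int_a^xf\right|$. *)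

(* Defs.v *)
From HB Require Import structures.
From mathcomp Require Import all_boot all_order all_algebra.
From mathcomp Require Import all_classical all_reals all_analysis.
Set Implicit Arguments. Unset Strict Implicit. Unset Printing Implicit Defensive.
Import Order.TTheory GRing.Theory Num.Theory.
Import numFieldNormedType.Exports.
Local Open Scope classical_set_scope.
Local Open Scope ring_scope.

Section Laplace.
Variable R : realType.
Implicit Types (F f : R -> R) (a b x d s : R).

Definition lap_right F x d s : R :=
  s ^+ 2 * \int[@lebesgue_measure R]_(t in `[0, d]) (expR (- (s * t)) * (F (x + t) - F x)).

Definition lap_left F x d s : R :=
  - s ^+ 2 * \int[@lebesgue_measure R]_(t in `[0, d]) (expR (- (s * t)) * (F (x - t) - F x)).

Local Open Scope ereal_scope.

Definition lowerLD a b F x : \bar R :=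
  Order.min
    (if (x < b)%R then limf_einf (fun s => (lap_right F x (b - x) s)%:E) (pinfty_nbhs R) else +oo)
    (if (a < x)%R then limf_einf (fun s => (lap_left F x (x - a) s)%:E) (pinfty_nbhs R) else +oo).

Definition upperLD a b F x : \bar R :=
  Order.max
    (if (x < b)%R then limf_esup (fun s => (lap_right F x (b - x) s)%:E) (pinfty_nbhs R) else -oo)
    (if (a < x)%R then limf_esup (fun s => (lap_left F x (x - a) s)%:E) (pinfty_nbhs R) else -oo).

Definition LP_major a b f U : Prop :=
  {within `[a, b], continuous U} /\
  forall x, (a <= x <= b)%R -> (f x)%:E <= lowerLD a b U x /\ -oo < lowerLD a b U x.

Definition LP_minor a b f V : Prop :=
  {within `[a, b], continuous V} /\
  forall x, (a <= x <= b)%R -> upperLD a b V x <= (f x)%:E /\ upperLD a b V x < +oo.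

Definition LP_integral a b f (I : R) : Prop :=
  ereal_sup [set ((V b - V a)%R)%:E | V in LP_minor a b f] = I%:E /\
  ereal_inf [set ((U b - U a)%R)%:E | U in LP_major a b f] = I%:E.

Definition LP_integrable a b f : Prop := exists I, LP_integral a b f I.

End Laplace.

(* Main.v *)
Require Import Defs.
From HB Require Import structures.
From mathcomp Require Import all_boot all_order all_algebra.
From mathcomp Require Import all_classical all_reals all_analysis.
From mathcomp Require Import ring lra.
Import Order.TTheory GRing.Theory Num.Theory.
Import numFieldNormedType.Exports.
Local Open Scope classical_set_scope.
Local Open Scope ring_scope.

(** If [U] is a major function of [0], then [U] is nondecreasing: for [r > 0]
    the right Laplace averages of [U + r x] at a maximum point other than the
    right endpoint would be nonpositive, although their lower limit is at least
    [r].  Hence [U - V] is nondecreasing for every major [U] and minor [V] of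
    [f], so [U - V] varies on each [a, x] by at most its variation on [a, b];
    as the averages over [0, d] and [0, d'] have the same limits, [U] and [V]
    also serve on [a, x].  Now take [U] and [V] with a small gap, and by
    Weierstrass a polynomial [q] uniformly close to [U]: then [U - q] and
    [V - q] are major and minor functions of [f - q'], and they squeeze its
    integral over each [a, x]. *)

(** * Laplace averages *)

Section LaplaceAverage.
Context {R : realType}.
Local Notation mu := (@lebesgue_measure R).

(** * Continuity relative to a set, and eventual form of lower limits *)

Lemma within_continuous_comp (A B : set R) (f g : R -> R) :
  {within B, continuous f} -> continuous g -> (forall t, A t -> B (g t)) ->
  {within A, continuous (f \o g)}.
Proof.
move=> /subspace_continuousP cf cg AB; apply/subspace_continuousP => t At /=.
apply: cvg_comp (cf (g t) (AB _ At)) => P BP.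
have : nbhs t (g @^-1` [set u | B u -> P u]) by apply: cg BP.
by apply: (@filterS _ (nbhs t)) => u /= Pu Au; exact: Pu (AB _ Au).
Qed.

Lemma within_continuousD (A : set R) (f g : R -> R) :
  {within A, continuous f} -> {within A, continuous g} ->
  {within A, continuous (fun t => f t + g t)}.
Proof. by move=> cf cg x; apply: cvgD; [exact: cf|exact: cg]. Qed.

Lemma within_continuousN (A : set R) (f : R -> R) :
  {within A, continuous f} -> {within A, continuous (fun t => - f t)}.
Proof. by move=> cf x; apply: cvgN; exact: cf. Qed.

Lemma within_continuousM (A : set R) (f g : R -> R) :
  {within A, continuous f} -> {within A, continuous g} ->
  {within A, continuous (fun t => f t * g t)}.
Proof. by move=> cf cg x; apply: cvgM; [exact: cf|exact: cg]. Qed.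

(** The lower limit is a supremum of infima over neighbourhoods of [+oo]; this supremum need not be
    attained, hence the slack [e]. *)
Lemma limf_einf_geP (g : R -> R) (r : R) :
  (r%:E <= limf_einf (fun s => (g s)%:E) (pinfty_nbhs R))%E <->
  forall e, 0 < e -> \forall s \near +oo, r - e <= g s.
Proof.
rewrite limf_einfE; split => [H e e0|H].
  have /ereal_sup_gt[_ [V FV <-] rV] : ((r - e)%:E <
      ereal_sup [set ereal_inf [set (g s)%:E | s in V] | V in pinfty_nbhs R])%E.
    by rewrite (lt_le_trans _ H)// lte_fin ltrBlDr ltrDl.
  apply: filterS FV => s Vs; rewrite -lee_fin (le_trans (ltW rV))//.
  by apply: ereal_inf_lbound; exists s.
apply/lee_subgt0Pr => e e0; rewrite -EFinB.
apply: (@le_trans _ _ (ereal_inf [set (g s)%:E | s in [set s | r - e <= g s]])).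
  by apply: le_ereal_inf_tmp => _ [s rs <-]; rewrite lee_fin.
by apply: ereal_sup_ubound; exists [set s | r - e <= g s] => //; exact: H.
Qed.

Lemma expR_linear_continuous (s : R) : continuous (fun t : R => expR (- (s * t))).
Proof.
move=> t; apply: continuous_comp; last exact: continuous_expR.
by apply: cvgN; apply: cvgMr; exact: cvg_id.
Qed.

Lemma laplace_integrable (h : R -> R) (c d s : R) : {within `[c, d], continuous h} ->
  mu.-integrable `[c, d] (EFin \o (fun t => expR (- (s * t)) * h t)).
Proof.
move=> ch; apply: continuous_compact_integrable; first exact: segment_compact.
apply: within_continuousM => //; apply: continuous_subspaceT.
exact: expR_linear_continuous.
Qed.

(** The factor [s ^+ 2] gives the kernel first moment 1 over the half-line, so the averages of an
    increment estimate a one-sided derivative. *)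
Definition laplace_avg (h : R -> R) (d s : R) : R :=
  s ^+ 2 * \int[mu]_(t in `[0, d]) (expR (- (s * t)) * h t).

Lemma eq_laplace_avg (h k : R -> R) d s : (forall t, 0 <= t <= d -> h t = k t) ->
  laplace_avg h d s = laplace_avg k d s.
Proof.
move=> hk; congr (_ * _); apply: eq_Rintegral => t; rewrite inE /= in_itv /= => td.
by rewrite hk.
Qed.

Lemma laplace_avgD (h k : R -> R) d s : {within `[0, d], continuous h} ->
  {within `[0, d], continuous k} ->
  laplace_avg (fun t => h t + k t) d s = laplace_avg h d s + laplace_avg k d s.
Proof.
move=> ch ck; rewrite /laplace_avg -mulrDr -RintegralD//; [|exact: laplace_integrable..].
by congr (_ * _); apply: eq_Rintegral => t _; rewrite mulrDr.
Qed.

Lemma laplace_avgN (h : R -> R) d s : {within `[0, d], continuous h} ->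
  laplace_avg (fun t => - h t) d s = - laplace_avg h d s.
Proof.
move=> ch; rewrite /laplace_avg -mulrN; congr (_ * _).
rewrite -mulN1r -RintegralZl//; last exact: laplace_integrable.
by apply: eq_Rintegral => t _; rewrite mulrN mulN1r.
Qed.

Lemma laplace_avg_le0 (h : R -> R) d s : {within `[0, d], continuous h} ->
  (forall t, 0 <= t <= d -> h t <= 0) -> laplace_avg h d s <= 0.
Proof.
move=> ch h0; rewrite -oppr_ge0 -laplace_avgN// mulr_ge0 ?sqr_ge0//.
apply: Rintegral_ge0 => t; rewrite /= in_itv /= => td.
by rewrite mulr_ge0 ?expR_ge0// oppr_ge0 h0.
Qed.

(** The term of degree [n.+1] of the exponential series already outgrows [s ^+ n]. *)
Lemma expR_decay (d : R) (n : nat) : 0 < d ->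
  s ^+ n * expR (- (s * d)) @[s --> +oo] --> 0.
Proof.
move=> d0; apply/cvgrPdist_le => e e0.
pose C := (n.+1)`!%:R / d ^+ n.+1.
have C0 : 0 < C by rewrite divr_gt0 ?exprn_gt0// ltr0n fact_gt0.
near=> s; have s0 : 0 < s by near: s; apply: nbhs_pinfty_gt; exact: num_real.
have sC : C / e <= s by near: s; apply: nbhs_pinfty_ge; exact: num_real.
rewrite sub0r normrN ger0_norm ?mulr_ge0 ?expR_ge0 ?exprn_ge0 ?(ltW s0)//.
rewrite expRN ler_pdivrMr ?expR_gt0//.
have sd0 : 0 <= s * d by rewrite mulr_ge0 ?(ltW s0) ?(ltW d0).
have := expR_ge1Dxn n sd0; move=> H.
have {}H : (s * d) ^+ n.+1 / n.+1`!%:R <= expR (s * d).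
  by lra.
rewrite (le_trans _ (ler_wpM2l (ltW e0) H))//.
have -> : (s * d) ^+ n.+1 / n.+1`!%:R = s ^+ n * (s / C).
  rewrite /C exprMn invf_div exprSr; ring.
rewrite mulrCA ler_peMr ?exprn_ge0 ?(ltW s0)//.
by rewrite mulrA ler_pdivlMr// mul1r -ler_pdivrMl// mulrC.
Unshelve. all: by end_near. Qed.

Lemma within_continuous_bounded (h : R -> R) (c d : R) : c <= d ->
  {within `[c, d], continuous h} ->
  exists2 M, 0 <= M & forall t, c <= t <= d -> `|h t| <= M.
Proof.
move=> cd ch; have [u _ umax] := EVT_max cd ch; have [v _ vmin] := EVT_min cd ch.
exists (`|h u| + `|h v|) => [|t tcd]; first by rewrite addr_ge0.
have hu := umax t tcd; have hv := vmin t tcd.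
have := ler_norm (h u); have := lerNnormlW (lexx `|h v|).
have := normr_ge0 (h u); have := normr_ge0 (h v).
by rewrite ler_norml => *; apply/andP; split; lra.
Qed.

(** On []d, d']] the kernel is at most [expR (- (s * d))], which beats the factor [s ^+ 2]. Limits
    of averages therefore depend only on [h] near 0. *)
Lemma laplace_avg_tail (h : R -> R) (d d' : R) : 0 < d -> d <= d' ->
  {within `[0, d'], continuous h} ->
  laplace_avg h d' s - laplace_avg h d s @[s --> +oo] --> 0.
Proof.
move=> d0 dd' ch.
have [M M0 hM] := within_continuous_bounded _ _ _ (le_trans (ltW d0) dd') ch.
have H : (d' - d) * M * (s ^+ 2 * expR (- (s * d))) @[s --> +oo] --> 0.
  by rewrite -[0](mulr0 ((d' - d) * M)); apply: cvgMr; exact: expR_decay.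
apply/cvgrPdist_le => e e0; move/cvgrPdist_le : H => /(_ e e0).
apply: filterS2 (nbhs_pinfty_gt (num_real 0)) => s s0.
rewrite !sub0r !normrN; apply: le_trans.
rewrite (le_trans _ (ler_norm _))//.
rewrite /laplace_avg -mulrBr Rintegral_itvB; last 3 first.
- exact: laplace_integrable.
- by rewrite bnd_simp ltW.
- by rewrite bnd_simp.
rewrite normrM ger0_norm ?sqr_ge0// [leRHS]mulrCA; apply: ler_wpM2l.
  exact: sqr_ge0.
have I : mu.-integrable `]d, d'] (EFin \o (fun t => expR (- (s * t)) * h t)).
  apply: (integrableS _ _ _ (laplace_integrable _ _ _ _ ch)) => //.
  by apply: subset_itv; rewrite bnd_simp// ltW.
apply: (le_trans (le_normr_Rintegral _ I)) => //.
move: dd'; rewrite le_eqVlt => /predU1P[<-|dd'].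
  by rewrite set_itv_ge ?Rintegral_set0 ?subrr ?mul0r// bnd_simp ltxx.
apply: (@le_trans _ _ (\int[mu]_(t in `]d, d']) (M * expR (- (s * d))))).
  apply: le_Rintegral => //.
  - exact: integrable_norm.
  - apply: (@integrableS _ _ _ mu `[d, d']) => //; first exact: subset_itv_oc_cc.
    apply: continuous_compact_integrable; first exact: segment_compact.
    by apply: continuous_subspaceT => ?; exact: cvg_cst.
  - move=> t; rewrite /= in_itv /= => /andP[dt td'].
    rewrite normrM ger0_norm ?expR_ge0// mulrC ler_pM ?expR_ge0//.
    + by apply: hM; rewrite td' andbT ltW// (lt_trans d0).
    + by rewrite ler_expR lerN2 ler_wpM2l// ltW.
rewrite Rintegral_cst//.
have -> : fine (mu `]d, d']) = d' - d by rewrite lebesgue_measure_itv/= lte_fin dd'.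
by rewrite mulrC mulrA.
Qed.

(** * Laplace averages of polynomials *)

Lemma is_derive_expR_horner (q : {poly R}) (s t : R) :
  is_derive t 1 (fun t => - (expR (- (s * t)) * q.[t]))
    (expR (- (s * t)) * (s *: q - q^`()).[t]).
Proof.
have dq : is_derive t 1 (horner q) q^`().[t].
  by apply: DeriveDef; [exact: derivable_horner|rewrite -derive1E derivE].
have de : is_derive t 1 (fun t : R => expR (- (s * t))) (expR (- (s * t)) * - s).
  have dl : is_derive t 1 (fun t : R => - (s * t)) (- s).
    by apply: is_derive_eq; rewrite scaler1.
  exact: (@is_derive1_comp _ expR (fun t : R => - (s * t))).
apply: is_derive_eq.
rewrite hornerD hornerN hornerZ; rewrite /GRing.scale /=. ring.
Qed.

(* Two integrations by parts, read as one explicit antiderivative. *)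
Lemma Rintegral_expR_horner (p : {poly R}) (d s : R) : 0 < d -> s != 0 ->
  \int[mu]_(t in `[0, d]) (expR (- (s * t)) * (p - s ^- 2 *: p^`()^`()).[t]) =
  (s^-1 *: p + s ^- 2 *: p^`()).[0] - expR (- (s * d)) * (s^-1 *: p + s ^- 2 *: p^`()).[d].
Proof.
move=> d0 s0; set q := s^-1 *: p + _.
pose F t := - (expR (- (s * t)) * q.[t]).
have dF (t : R) : is_derive t 1 F (expR (- (s * t)) * (p - s ^- 2 *: p^`()^`()).[t]).
  have -> : p - s ^- 2 *: p^`()^`() = s *: q - q^`().
    rewrite /q scalerDr derivD !derivZ !scalerA mulfV// scale1r expr2 invfM mulrA mulfV// mul1r.
    by rewrite opprD addrA addrK.
  exact: is_derive_expR_horner.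
rewrite /Rintegral (@continuous_FTC2 _ _ F)//=.
- by rewrite /F mulr0 oppr0 expR0 mul1r opprK addrC.
- apply: continuous_subspaceT => t; apply: cvgM; first exact: expR_linear_continuous.
  exact: continuous_horner.
- have cF : continuous F.
    move=> t; have [/derivable1_diffP dFt _] := dF t.
    exact: differentiable_continuous dFt.
  split => [t _||].
  + by have [] := dF t.
  + by apply: cvg_at_right_filter; exact: cF.
  + by apply: cvg_at_left_filter; exact: cF.
- by move=> t _; rewrite derive1E derive_val.
Qed.


Lemma laplace_avg_horner (p : {poly R}) (d : R) : 0 < d -> p.[0] = 0 ->
  laplace_avg (horner p) d s @[s --> +oo] --> p^`().[0].
Proof.
move=> d0 p0.
have cp (q : {poly R}) : {within `[0, d], continuous (horner q)}.
  by apply: continuous_subspaceT => t; exact: continuous_horner.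
have [M M0 hM] := within_continuous_bounded _ _ _ (ltW d0) (cp p^`()^`()).
(* These terms bound the error: two boundary terms at [d], then the remaining integral. *)
have H : `|p.[d]| * (s ^+ 1 * expR (- (s * d))) +
    `|p^`().[d]| * (s ^+ 0 * expR (- (s * d))) + M * s^-1 @[s --> +oo] --> 0.
  have -> : (0 : R) = `|p.[d]| * 0 + `|p^`().[d]| * 0 + M * 0.
    by rewrite !mulr0 !addr0.
  apply: cvgD; first by apply: cvgD; apply: cvgMr; exact: expR_decay.
  apply: cvgMr; apply/gtr0_cvgV0; last exact: cvg_id.
  exact: nbhs_pinfty_gt (num_real 0).
apply/cvgrPdist_le => e e0; move/cvgrPdist_le : H => /(_ e e0).
apply: filterS2 (nbhs_pinfty_gt (num_real 0)) => s s0.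
rewrite sub0r normrN expr1 expr0 mul1r; apply: le_trans.
rewrite (le_trans _ (ler_norm _))//.
have sn0 : s != 0 by rewrite gt_eqF.
have E (q : {poly R}) : \int[mu]_(t in `[0, d]) (expR (- (s * t)) * q.[t]) =
  s ^- 2 * \int[mu]_(t in `[0, d]) (expR (- (s * t)) * q^`()^`().[t]) +
  (s^-1 * q.[0] + s ^- 2 * q^`().[0]
    - expR (- (s * d)) * (s^-1 * q.[d] + s ^- 2 * q^`().[d])).
  have := Rintegral_expR_horner q d s d0 sn0; rewrite !(hornerD, hornerZ) => <-.
  rewrite -RintegralZl//; last exact: laplace_integrable.
  rewrite -RintegralD//.
  - by apply: eq_Rintegral => t _; rewrite hornerD hornerN hornerZ; ring.
  - by apply: (integrableZl _ (s ^- 2) (laplace_integrable _ _ _ _ (cp _))).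
  - exact: laplace_integrable.
have Ip : `|\int[mu]_(t in `[0, d]) (expR (- (s * t)) * p^`()^`().[t])| <= M * s^-1.
  apply: le_trans (le_normr_Rintegral _ (laplace_integrable _ _ _ _ (cp _))) _ => //.
  apply: (@le_trans _ _ (\int[mu]_(t in `[0, d]) (expR (- (s * t)) * M%:P.[t]))).
    apply: le_Rintegral => //.
    - exact/integrable_norm/laplace_integrable.
    - exact: laplace_integrable.
    - move=> t; rewrite /= in_itv /= => td.
      by rewrite normrM ger0_norm ?expR_ge0// hornerC ler_wpM2l ?expR_ge0// hM.
  (* For a constant polynomial the second derivative vanishes, so [E] evaluates the integral of the
     kernel in closed form. *)
  rewrite E derivC deriv0 !horner0 !hornerC !mulr0 !addr0.
  under eq_Rintegral do rewrite horner0 mulr0.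
  rewrite Rintegral_cst// mul0r mulr0 add0r mulrC lerBlDr lerDl.
  by rewrite mulr_ge0 ?expR_ge0// mulr_ge0// invr_ge0 ltW.
rewrite /laplace_avg E p0 mulr0 add0r.
rewrite distrC.
set I := Rintegral _ _ _ in Ip *; set ex := expR _.
have -> : s ^+ 2 * (s ^- 2 * I + (s ^- 2 * p^`().[0] -
    ex * (s^-1 * p.[d] + s ^- 2 * p^`().[d]))) - p^`().[0] =
    I + - (p.[d] * (s * ex)) + - (p^`().[d] * ex) by field.
rewrite (le_trans (ler_normD _ _))// (le_trans (lerD (ler_normD _ _) (lexx _)))//.
rewrite !normrN !normrM (gtr0_norm s0) (ger0_norm (expR_ge0 _)) -addrA addrC.
by rewrite lerD2l.
Qed.

End LaplaceAverage.

(** * Weierstrass approximation *)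

Section Weierstrass.
Context {R : realType}.

(* The polynomial [\sum_k 'C(n, k) phi k 'X^k (1 - 'X)^(n - k)], by conditioning
   on the first of [n] coin tosses. *)
Fixpoint bernstein (n : nat) (phi : nat -> R) : {poly R} :=
  if n is m.+1
  then 'X * bernstein m (phi \o succn) + (1 - 'X) * bernstein m phi
  else (phi 0%N)%:P.

(* The last factor is the second moment about [c] of the binomial law; leaving
   [c] free is what makes the induction on [n] go through. *)
Lemma bernstein_approx n (phi : nat -> R) (y e C c x : R) : 0 <= x <= 1 ->
  (forall k, (k <= n)%N -> `|phi k - y| <= e + C * (k%:R - c) ^+ 2) ->
  `|(bernstein n phi).[x] - y|
    <= e + C * ((n%:R * x - c) ^+ 2 + n%:R * (x * (1 - x))).
Proof.
move=> /andP[x0 x1]; elim: n phi c => [|n IH] phi c H /=.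
  by rewrite hornerC (le_trans (H 0%N _))// !mul0r addr0.
(* A first success raises the count by one, which amounts to moving the centre from [c] to
   [c - 1]. *)
have /IH H1 : forall k, (k <= n)%N ->
    `|(phi \o succn) k - y| <= e + C * (k%:R - (c - 1)) ^+ 2.
  move=> k kn; have -> : k%:R - (c - 1) = k.+1%:R - c by rewrite -natr1; ring.
  exact: H.
have /IH H2 : forall k, (k <= n)%N -> `|phi k - y| <= e + C * (k%:R - c) ^+ 2.
  by move=> k kn; apply: H; rewrite ltnW.
have -> : ('X * bernstein n (phi \o succn) + (1 - 'X) * bernstein n phi).[x] =
    x * (bernstein n (phi \o succn)).[x] + (1 - x) * (bernstein n phi).[x].
  by rewrite !hornerE.
move: (bernstein n (phi \o succn)).[x] (bernstein n phi).[x] H1 H2 => A B H1 H2.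
have -> : x * A + (1 - x) * B - y = x * (A - y) + (1 - x) * (B - y) by ring.
rewrite (le_trans (ler_normD _ _))// !normrM (ger0_norm x0).
rewrite (@ger0_norm _ (1 - x)) ?subr_ge0//.
have x1' : 0 <= 1 - x by rewrite subr_ge0.
(* The two second moments, mixed with weights [x] and [1 - x], give exactly the one for [n.+1]
   tosses. *)
have := lerD (ler_wpM2l x0 H1) (ler_wpM2l x1' H2); congr (_ <= _).
by rewrite -natr1; ring.
Qed.

(** Close points are handled by [e], distant ones by the quadratic term; compactness makes [C]
    uniform. The quadratic shape is the one that [bernstein_approx] averages. *)
Lemma within_continuous_modulus (a b : R) (G : R -> R) (e : R) : a <= b ->
  {within `[a, b], continuous G} -> 0 < e ->
  exists C, forall s t, a <= s <= b -> a <= t <= b ->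
    `|G s - G t| <= e + C * (s - t) ^+ 2.
Proof.
move=> ab cG e0.
have [c _ cmax] := EVT_max ab cG.
have [d _ dmin] := EVT_min ab cG.
pose M := G c - G d.
have GM s t : a <= s <= b -> a <= t <= b -> `|G s - G t| <= M.
  move=> sab tab; have := cmax s sab; have := dmin s sab.
  have := cmax t tab; have := dmin t tab; rewrite ler_norml /M.
  by move=> *; apply/andP; split; lra.
have M0 : 0 <= M by rewrite (le_trans _ (GM a a _ _)) ?lexx.
have /compact_near_coveringP cov := @segment_compact R a b.
have := cov R +oo (fun C s => a <= s <= b -> forall t, a <= t <= b ->
    `|G s - G t| <= e + C * (s - t) ^+ 2) _ _.
case.
- move=> x /= xab; move/subspace_continuousP : cG => /(_ x xab).
  move=> /cvgrPdist_lt /(_ (e / 2)); rewrite divr_gt0// => /(_ isT).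
  rewrite /within /= => /nbhs_ballP[r /= r0 xr].
  (* If [s] and [t] are closer than [r / 2], both lie within [r] of [x]; otherwise such a [C] makes
     the quadratic term alone dominate the oscillation [M]. *)
  exists (ball x (r / 2), [set C | M / (r / 2) ^+ 2 <= C]).
    split => /=; first by apply: (@nbhsx_ballx _ R^o); rewrite divr_gt0.
    by apply: nbhs_pinfty_ge; exact: num_real.
  move=> [s C] /= [xs MC] sab t tab.
  have xs' : `|x - s| < r / 2 by [].
  have r2 : 0 < r / 2 by rewrite divr_gt0.
  have C0 : 0 <= C by rewrite (le_trans _ MC)// divr_ge0// sqr_ge0.
  have Gxs y : `|x - y| < r -> a <= y <= b -> `|G x - G y| < e / 2.
    by move=> xy yab; apply: xr.
  have [st|st] := ltP `|s - t| (r / 2).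
    have Gs : `|G x - G s| < e / 2 by apply: Gxs => //; lra.
    have Gt : `|G x - G t| < e / 2.
      by apply: Gxs => //; have := ler_distD s x t; lra.
    have := ler_distD (G x) (G s) (G t); rewrite (distrC (G s) (G x)).
    by have := mulr_ge0 C0 (sqr_ge0 (s - t)); lra.
  rewrite (le_trans (GM s t sab tab))// (@le_trans _ _ (C * (r / 2) ^+ 2))//.
    by rewrite -ler_pdivrMr// exprn_gt0.
  rewrite ler_wpDl ?(ltW e0)// ler_wpM2l// -[leRHS]real_normK ?num_real//.
  by rewrite ler_sqr ?nnegrE// ltW.
move=> N [_ HN]; exists (N + 1) => s t sab tab.
have sab' : s \in `[a, b] by rewrite /= in_itv.
by apply: (HN (N + 1) _ s sab' sab) => //=; rewrite ltrDl.
Qed.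

(** Centring the binomial law at its mean [n%:R * x] leaves only its variance, which after rescaling
    by [n] is at most [1 / n]. *)
Lemma weierstrass01 (G : R -> R) (e : R) : {within `[0, 1], continuous G} -> 0 < e ->
  exists q : {poly R}, forall x, 0 <= x <= 1 -> `|q.[x] - G x| <= e.
Proof.
move=> cG e0; have e2 : 0 < e / 2 by rewrite divr_gt0.
have [C HC] := within_continuous_modulus _ _ _ _ ler01 cG e2.
(* Large enough for the variance term to cost at most [e / 2]; the absolute value is there because
   the sign of [C] is unknown. *)
pose n := (Num.bound (`|C| / (e / 2))).+1.
have n0 : 0 < n%:R :> R by rewrite ltr0n.
exists (bernstein n (fun k => G (k%:R / n%:R))) => x x01.
have H k : (k <= n)%N -> `|G (k%:R / n%:R) - G x|
    <= e / 2 + C / n%:R ^+ 2 * (k%:R - n%:R * x) ^+ 2.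
  move=> kn.
  have -> : C / n%:R ^+ 2 * (k%:R - n%:R * x) ^+ 2 = C * (k%:R / n%:R - x) ^+ 2.
    by field; rewrite gt_eqF.
  apply: HC => //; rewrite divr_ge0//= ler_pdivrMr// mul1r ler_nat//.
rewrite (le_trans (bernstein_approx _ _ _ _ _ _ _ x01 H))//.
rewrite subrr expr0n add0r /=.
have -> : C / n%:R ^+ 2 * (n%:R * (x * (1 - x))) = C / n%:R * (x * (1 - x)).
  by field; rewrite gt_eqF.
have Cn : `|C| / n%:R <= e / 2.
  rewrite ler_pdivrMr// mulrC -ler_pdivrMr//.
  apply: (le_trans (ltW (archi_boundP _))); last by rewrite ler_nat.
  by rewrite divr_ge0// ltW.
have := ler_norm (C / n%:R); rewrite normrM normfV (gtr0_norm n0) => CC.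
have : C / n%:R * (x * (1 - x)) <= e / 2 * 1; last by lra.
have x1 : 0 <= x * (1 - x) by nra.
rewrite (le_trans (ler_wpM2r x1 (le_trans CC Cn)))// ler_wpM2l ?ltW//; nra.
Qed.

Lemma weierstrass (a b : R) (G : R -> R) (e : R) : a < b ->
  {within `[a, b], continuous G} -> 0 < e ->
  exists q : {poly R}, forall x, a <= x <= b -> `|q.[x] - G x| <= e.
Proof.
move=> ab cG e0.
have ba : 0 < b - a by rewrite subr_gt0.
have cg : continuous (fun t : R => a + (b - a) * t).
  by move=> t; apply: cvgD; [exact: cvg_cst|apply: cvgMr; exact: cvg_id].
have [|q Hq] := weierstrass01 (G \o (fun t => a + (b - a) * t)) e _ e0.
  apply: within_continuous_comp cG cg _ => t; rewrite /= !in_itv /=; nra.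
exists (q \Po ((b - a)^-1 *: ('X - a%:P))) => x /andP[ax xb].
rewrite horner_comp !hornerE.
have := Hq ((b - a)^-1 * (x - a)); rewrite /= mulVKf ?gt_eqF// subrKC; apply.
by rewrite mulr_ge0 ?invr_ge0 ?(ltW ba) ?subr_ge0//= mulrC ler_pdivrMr// mul1r lerB.
Qed.

End Weierstrass.

(** * Major and minor functions *)

Section MajorMinor.
Context {R : realType}.
Implicit Types (a b c d x : R) (f g h k U V W : R -> R) (q : {poly R}).

(* The lower limit of [laplace_avg h d s] as [s] tends to [+oo] is at least [r]. *)
Definition laplace_ge h d (r : R) :=
  forall e, 0 < e -> \forall s \near +oo, r - e <= laplace_avg h d s.

Lemma laplace_geD h k d (r r' : R) : {within `[0, d], continuous h} ->
  {within `[0, d], continuous k} -> laplace_ge h d r -> laplace_ge k d r' ->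
  laplace_ge (fun t => h t + k t) d (r + r').
Proof.
move=> ch ck hr kr e e0; have e2 : 0 < e / 2 by rewrite divr_gt0.
apply: filterS2 (hr _ e2) (kr _ e2) => s H1 H2.
by rewrite laplace_avgD//; lra.
Qed.

Lemma eq_laplace_ge h k d (r : R) : h =1 k -> laplace_ge h d r -> laplace_ge k d r.
Proof. by move=> /funext ->. Qed.

Lemma cvg_laplace_ge h d (r : R) : laplace_avg h d s @[s --> +oo] --> r ->
  laplace_ge h d r.
Proof.
move=> /cvgrPdist_le H e e0; apply: filterS (H e e0) => s.
by rewrite ler_norml => /andP[_]; lra.
Qed.

(** The discarded tail tends to 0; restriction of major functions to subintervals rests on this. *)
Lemma laplace_geS h d d' (r : R) : 0 < d' -> d' <= d ->
  {within `[0, d], continuous h} -> laplace_ge h d r -> laplace_ge h d' r.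
Proof.
move=> d0 dd' ch hr e e0; have e2 : 0 < e / 2 by rewrite divr_gt0.
have /cvgrPdist_le /(_ _ e2) H := laplace_avg_tail _ _ _ d0 dd' ch.
apply: filterS2 (hr _ e2) H => s H1.
by rewrite sub0r normrN ler_norml => /andP[_]; lra.
Qed.

(** * Major and minor functions through averages of increments *)

Lemma right_increment_continuous a b U x : {within `[a, b], continuous U} ->
  a <= x -> {within `[0, b - x], continuous (fun t => U (x + t) - U x)}.
Proof.
move=> cU ax; apply: within_continuousD; last first.
  by apply: continuous_subspaceT => ?; exact: cvg_cst.
apply: (within_continuous_comp _ _ _ (fun t => x + t) cU).
  by move=> t; apply: cvgD; [exact: cvg_cst|exact: cvg_id].
by move=> t; rewrite /= !in_itv /= => /andP[t0 tb]; apply/andP; split; lra.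
Qed.

Lemma left_increment_continuous a b U x : {within `[a, b], continuous U} ->
  x <= b -> {within `[0, x - a], continuous (fun t => U x - U (x - t))}.
Proof.
move=> cU xb; apply: within_continuousD.
  by apply: continuous_subspaceT => ?; exact: cvg_cst.
apply: within_continuousN.
apply: (within_continuous_comp _ _ _ (fun t => x - t) cU).
  by move=> t; apply: cvgB; [exact: cvg_cst|exact: cvg_id].
by move=> t; rewrite /= !in_itv /= => /andP[t0 tb]; apply/andP; split; lra.
Qed.

(** Moving the minus sign into the increment lets both sides share one notion of average. *)
Lemma lap_leftE a b U x s : {within `[a, b], continuous U} -> x <= b ->
  lap_left U x (x - a) s = laplace_avg (fun t => U x - U (x - t)) (x - a) s.
Proof.
move=> cU xb; rewrite /lap_left mulNr.
rewrite -[LHS]/(- laplace_avg (fun t => U (x - t) - U x) (x - a) s).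
rewrite (eq_laplace_avg _ (fun t => - (U x - U (x - t)))) => [|t _]; last first.
  by rewrite opprB.
by rewrite laplace_avgN ?opprK//; exact: left_increment_continuous cU xb.
Qed.

(** The minimum splits into its two one-sided conditions; at an endpoint the missing side has the
    value [+oo] and imposes nothing. *)
Lemma LP_majorP a b f U : LP_major a b f U <->
  {within `[a, b], continuous U} /\ forall x, a <= x <= b ->
    (x < b -> laplace_ge (fun t => U (x + t) - U x) (b - x) (f x)) /\
    (a < x -> laplace_ge (fun t => U x - U (x - t)) (x - a) (f x)).
Proof.
split=> -[cU H]; split=> // x xab; have /andP[ax xb] := xab.
  have [+ _] := H x xab; rewrite /lowerLD le_min => /andP[H1 H2]; split=> [xb'|ax'].
    by move: H1; rewrite xb' => /limf_einf_geP.
  move: H2; rewrite ax' => /limf_einf_geP H2 e e0.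
  by apply: filterS (H2 e e0) => s; rewrite (lap_leftE _ _ _ _ _ cU).
have [H1 H2] := H x xab.
suff fU : ((f x)%:E <= lowerLD a b U x)%E.
  by split=> //; apply: lt_le_trans fU; rewrite ltNyr.
rewrite /lowerLD le_min; apply/andP; split; case: ifPn => xlt; rewrite ?leey//.
  by apply/limf_einf_geP; exact: H1.
apply/limf_einf_geP => e e0; apply: filterS (H2 xlt e e0) => s.
by rewrite (lap_leftE _ _ _ _ _ cU).
Qed.

Lemma limf_esup_leN (g : R -> R) (r : R) :
  (limf_esup (fun s => (g s)%:E) (pinfty_nbhs R) <= r%:E)%E =
  ((- r)%:E <= limf_einf (fun s => (- g s)%:E) (pinfty_nbhs R))%E.
Proof.
rewrite -leeN2 EFinN -limf_einfN; congr (_ <= limf_einf _ _)%E.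
Qed.

(** Negation exchanges upper and lower limits, so facts on minor functions reduce to those on major
    functions. *)
Lemma LP_minorN a b f V :
  LP_minor a b f V <-> LP_major a b (fun x => - f x) (fun x => - V x).
Proof.
have cN : {within `[a, b], continuous V} <->
    {within `[a, b], continuous (fun x => - V x)}.
  split=> [|/within_continuousN]; first exact: within_continuousN.
  by rewrite (_ : (fun t => - - V t) = V)//; apply/funext => t; rewrite opprK.
have rN x s : {within `[a, b], continuous V} -> a <= x ->
    - lap_right V x (b - x) s = lap_right (fun x => - V x) x (b - x) s.
  move=> cV ax; rewrite -[lap_right V x _ _]/(laplace_avg _ _ s).
  rewrite -laplace_avgN; last exact: right_increment_continuous cV ax.
  by apply: eq_laplace_avg => t _; rewrite opprD.
have lN x s : {within `[a, b], continuous V} -> x <= b ->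
    - lap_left V x (x - a) s = lap_left (fun x => - V x) x (x - a) s.
  move=> cV xb; rewrite (lap_leftE _ _ _ _ _ cV)// (lap_leftE _ _ _ _ _ (cN.1 cV))//.
  rewrite -laplace_avgN; last exact: left_increment_continuous cV xb.
  by apply: eq_laplace_avg => t _; rewrite opprD.
have LN x : {within `[a, b], continuous V} -> a <= x <= b ->
    ((upperLD a b V x <= (f x)%:E) =
     ((- f x)%:E <= lowerLD a b (fun x => - V x)%R x))%E.
  move=> cV /andP[ax xb]; rewrite /upperLD /lowerLD ge_max le_min.
  congr (_ && _); case: ifPn => xlt; rewrite ?leey ?leNye//.
    by rewrite limf_esup_leN; under eq_fun do rewrite rN//.
  by rewrite limf_esup_leN; under eq_fun do rewrite lN//.
split=> -[cV H]; split=> [|x xab].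
- exact: cN.1.
- have [] := H x xab; rewrite LN// => fV _; split=> //.
  by apply: lt_le_trans fV; rewrite ltNyr.
- exact: cN.2.
- have [] := H x xab; rewrite -LN//; last exact: cN.2.
  by move=> fV _; split=> //; apply: le_lt_trans fV _; rewrite ltry.
Qed.

Lemma LP_majorD a b f g U W : LP_major a b f U -> LP_major a b g W ->
  LP_major a b (fun x => f x + g x) (fun x => U x + W x).
Proof.
move=> /LP_majorP[cU HU] /LP_majorP[cW HW]; apply/LP_majorP.
split=> [|x xab]; first exact: within_continuousD.
have /andP[ax xb] := xab.
have [U1 U2] := HU x xab; have [W1 W2] := HW x xab; split=> [xb'|ax'].
- have := laplace_geD _ _ _ _ _ (right_increment_continuous _ _ _ _ cU ax)
    (right_increment_continuous _ _ _ _ cW ax) (U1 xb') (W1 xb').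
  by apply: eq_laplace_ge => t; ring.
- have := laplace_geD _ _ _ _ _ (left_increment_continuous _ _ _ _ cU xb)
    (left_increment_continuous _ _ _ _ cW xb) (U2 ax') (W2 ax').
  by apply: eq_laplace_ge => t; ring.
Qed.

Lemma LP_majorS a b c d f U : a <= c -> d <= b ->
  LP_major a b f U -> LP_major c d f U.
Proof.
move=> ac db /LP_majorP[cU H]; apply/LP_majorP; split=> [|x /andP[cx xd]].
  by apply: continuous_subspaceW cU; apply: subset_itv; rewrite bnd_simp.
have ax : a <= x := le_trans ac cx; have xb : x <= b := le_trans xd db.
have [H1 H2] := H x (introT andP (conj ax xb)); split=> lt.
- apply: (laplace_geS _ (b - x)); rewrite ?subr_gt0 ?lerB//.
    exact: right_increment_continuous cU ax.
  exact/H1/(lt_le_trans lt).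
- apply: (laplace_geS _ (x - a)); rewrite ?subr_gt0 ?lerB//.
    exact: left_increment_continuous cU xb.
  exact/H2/(le_lt_trans ac).
Qed.

Lemma LP_minorS a b c d f V : a <= c -> d <= b ->
  LP_minor a b f V -> LP_minor c d f V.
Proof. by move=> ac db /LP_minorN H; apply/LP_minorN/(LP_majorS a b). Qed.

Lemma LP_major_horner a b q : LP_major a b (horner q^`()) (horner q).
Proof.
apply/LP_majorP; split=> [|x _].
  by apply: continuous_subspaceT => t; exact: continuous_horner.
split=> lt; apply: cvg_laplace_ge.
- pose P := q \Po ('X + x%:P) - q.[x]%:P.
  have -> : (fun t => q.[x + t] - q.[x]) = horner P.
    by apply/funext => t; rewrite /P hornerD hornerN hornerC horner_comp !hornerE [t + x]addrC.
  have -> : q^`().[x] = P^`().[0].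
    by rewrite derivB deriv_comp derivC derivD derivX derivC addr0 subr0 mulr1
      horner_comp !hornerE ?add0r.
  apply: laplace_avg_horner; first by rewrite subr_gt0.
  by rewrite /P hornerD hornerN hornerC horner_comp !hornerE ?add0r subrr.
- pose P := q.[x]%:P - (q \Po (x%:P - 'X)).
  have -> : (fun t => q.[x] - q.[x - t]) = horner P.
    by apply/funext => t; rewrite /P hornerD hornerN hornerC horner_comp !hornerE.
  have -> : q^`().[x] = P^`().[0].
    by rewrite derivB deriv_comp derivC derivB derivX derivC !sub0r mulrN1 opprK
      horner_comp !hornerE ?subr0.
  apply: laplace_avg_horner; first by rewrite subr_gt0.
  by rewrite /P hornerD hornerN hornerC horner_comp !hornerE ?subr0 subrr.
Qed.

Lemma LP_major_subr a b f U q : LP_major a b f U ->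
  LP_major a b (fun x => f x - q^`().[x]) (fun x => U x - q.[x]).
Proof.
move=> /LP_majorD /(_ (LP_major_horner a b (- q))).
congr LP_major; apply/funext => x; first by rewrite derivN hornerN.
by rewrite hornerN.
Qed.

Lemma LP_minor_subr a b f V q : LP_minor a b f V ->
  LP_minor a b (fun x => f x - q^`().[x]) (fun x => V x - q.[x]).
Proof.
move=> /LP_minorN /LP_majorD /(_ (LP_major_horner a b q)) H; apply/LP_minorN.
by move: H; congr LP_major; apply/funext => x; rewrite opprB addrC.
Qed.

Lemma LP_minor_horner a b q : LP_minor a b (horner q^`()) (horner q).
Proof.
apply/LP_minorN; have := LP_major_horner a b (- q).
by congr LP_major; apply/funext => x; rewrite ?derivN hornerN.
Qed.

(** * Monotonicity, comparison, and the gap criterion for integrability *)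

Lemma LP_major0_le a b U : a <= b -> LP_major a b (fun=> 0) U -> U a <= U b.
Proof.
rewrite le_eqVlt => /predU1P[<-//|ab] HU; apply/ler_addgt0Pr => e e0.
(* With this slope the added linear function grows by exactly [e] over the interval. *)
pose r := e / (b - a).
have r0 : 0 < r by rewrite divr_gt0// subr_gt0.
have /LP_majorP[cW HW] := LP_majorD _ _ _ _ _ _ HU (LP_major_horner a b (r *: 'X)).
have [c + cmax] := EVT_max (ltW ab) cW.
rewrite in_itv /= => cab; have /andP[ac cb] := cab.
have cb' : c = b.
  apply/eqP; rewrite eq_le cb leNgt; apply/negP => cb'.
  have [H _] := HW c cab.
  (* With tolerance [r / 2], some average is at least [r / 2 > 0], against the sign forced by the
     maximum. *)
  have r2 : 0 < r / 2 by rewrite divr_gt0.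
  have [s] := filter_ex (H cb' _ r2); rewrite derivZ derivX hornerZ hornerC mulr1 add0r.
  apply/negP; rewrite -ltNge (@le_lt_trans _ _ 0)//; last lra.
  apply: laplace_avg_le0; first exact: right_increment_continuous cW ac.
  move=> t /andP[t0 tb]; rewrite subr_le0; apply: cmax.
  by rewrite in_itv /=; apply/andP; split; lra.
have := cmax a; rewrite in_itv /= lexx ltW// cb' => /(_ isT).
rewrite !hornerZ !hornerX => H.
have : r * b - r * a = e by rewrite -mulrBr /r divfK// gt_eqF// subr_gt0.
by lra.
Qed.

Lemma LP_minor_le_major a b f U V : a <= b -> LP_major a b f U ->
  LP_minor a b f V -> V b - V a <= U b - U a.
Proof.
move=> ab HU /LP_minorN HV; have := LP_majorD _ _ _ _ _ _ HU HV.
under eq_fun do rewrite subrr.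
by move=> /(LP_major0_le _ _ _ ab); lra.
Qed.

(** Comparison puts the supremum below the infimum, small gaps make them equal, and any one pair
    makes the common value finite. *)
Lemma LP_integral_of_gap a b f : a <= b ->
  (forall e, 0 < e -> exists U V, [/\ LP_major a b f U, LP_minor a b f V &
    (U b - U a) - (V b - V a) <= e]) ->
  exists K, LP_integral a b f K /\ forall U V, LP_major a b f U ->
    LP_minor a b f V -> V b - V a <= K <= U b - U a.
Proof.
move=> ab gap; have [U1 [V1 [HU1 HV1 _]]] := gap 1 ltr01.
set S := ereal_sup [set ((V b - V a)%R)%:E | V in LP_minor a b f].
set I := ereal_inf [set ((U b - U a)%R)%:E | U in LP_major a b f].
have VS V : LP_minor a b f V -> ((V b - V a)%:E <= S)%E.
  by move=> HV; apply: ereal_sup_ubound; exists V.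
have IU U : LP_major a b f U -> (I <= (U b - U a)%:E)%E.
  by move=> HU; apply: ereal_inf_lbound; exists U.
have SU U : LP_major a b f U -> (S <= (U b - U a)%:E)%E.
  move=> HU; apply: ge_ereal_sup => _ [V HV <-].
  by rewrite lee_fin; exact: LP_minor_le_major HU HV.
have SI : (S <= I)%E by apply: le_ereal_inf_tmp => _ [U HU <-]; exact: SU.
have IS : (I <= S)%E.
  apply/lee_addgt0Pr => e /gap[U [V [HU HV UV]]].
  rewrite (le_trans (IU _ HU))// (@le_trans _ _ ((V b - V a)%:E + e%:E)%E)//.
    by rewrite -EFinD lee_fin; lra.
  by rewrite leeD2r// VS.
have Sfin : S = (fine S)%:E.
  rewrite fineK// fin_numE; apply/andP; split; apply/eqP => SE.
    by have := VS _ HV1; rewrite SE leeNy_eq.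
  by have := SU _ HU1; rewrite SE leye_eq.
have IE : I = S by apply/eqP; rewrite eq_le IS SI.
exists (fine S); split; first by split; rewrite -Sfin.
move=> U V HU HV; apply/andP; split; rewrite -lee_fin -Sfin; [exact: VS|exact: SU].
Qed.

Lemma LP_integrable_gap a b f : LP_integrable a b f -> forall e, 0 < e ->
  exists U V, [/\ LP_major a b f U, LP_minor a b f V &
    (U b - U a) - (V b - V a) <= e].
Proof.
move=> [I [supI infI]] e e0; have e2 : 0 < e / 2 by rewrite divr_gt0.
have [] := @ub_ereal_sup_adherent R [set ((V b - V a)%R)%:E | V in LP_minor a b f] _ e2.
  by rewrite supI.
move=> _ [V HV <-]; rewrite supI -EFinB lte_fin => VI.
have [] := @lb_ereal_inf_adherent R [set ((U b - U a)%R)%:E | U in LP_major a b f] _ e2.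
  by rewrite infI.
move=> _ [U HU <-]; rewrite infI -EFinD lte_fin => UI.
by exists U, V; split=> //; lra.
Qed.

(** The difference of the two gaps is the increment of [U - V] over [[x, b]], nonnegative by
    comparison there. *)
Lemma LP_gap_le a b f U V x : a <= x <= b -> LP_major a b f U ->
  LP_minor a b f V -> (U x - U a) - (V x - V a) <= (U b - U a) - (V b - V a).
Proof.
move=> /andP[ax xb] /(LP_majorS _ _ _ _ _ _ ax (lexx b)) HU.
move=> /(LP_minorS _ _ _ _ _ _ ax (lexx b)) HV.
by have := LP_minor_le_major _ _ _ _ _ xb HU HV; lra.
Qed.

End MajorMinor.

(** The bound on the integral over every [[a, x]] spells out that the Alexiewicz norm of [f - p] is
    at most [e]. *)
Theorem theorem5p11 (R : realType) (a b : R) (ab : a < b)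
  (f : R -> R) (Hf : LP_integrable a b f) (e : R) (he : 0 < e) :
  exists p : {poly R},
    LP_integrable a b (fun t => p.[t]) /\
    forall x : R, a <= x <= b ->
      exists K : R, LP_integral a x (fun t => f t - p.[t]) K /\ `|K| <= e.
Proof.
(* The final estimate spends this three times: on the gap between [U] and [V], and on the
   approximation of [U] by [q] at [a] and at [x]. *)
have e4 : 0 < e / 4 by rewrite divr_gt0.
have [U [V [HU HV UV]]] := LP_integrable_gap _ _ _ Hf _ e4.
have [q Hq] := weierstrass _ _ _ _ ab HU.1 e4.
exists q^`(); split.
  have [|K [HK _]] := LP_integral_of_gap a b (horner q^`()) (ltW ab); last by exists K.
  (* As [q] is both a major and a minor function of its derivative, the gap is zero. *)
  move=> r r0; exists (horner q), (horner q).
  split; [exact: LP_major_horner|exact: LP_minor_horner|by rewrite subrr ltW].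
move=> x xab; have /andP[ax xb] := xab.
have major W : LP_major a b f W ->
    LP_major a x (fun t => f t - q^`().[t]) (fun t => W t - q.[t]).
  by move=> /(LP_majorS _ _ _ _ _ _ (lexx a) xb)/LP_major_subr.
have minor W : LP_minor a b f W ->
    LP_minor a x (fun t => f t - q^`().[t]) (fun t => W t - q.[t]).
  by move=> /(LP_minorS _ _ _ _ _ _ (lexx a) xb)/LP_minor_subr.
have [|K [HK KUV]] := LP_integral_of_gap a x (fun t => f t - q^`().[t]) ax.
  (* Existence of the integral demands arbitrarily small gaps, hence fresh pairs here; the fixed [U]
     and [V] serve only to bound its value. Subtracting [q] from both functions leaves the gap
     unchanged. *)
  move=> r /(LP_integrable_gap _ _ _ Hf)[U' [V' [HU' HV' UV']]].
  exists (fun t => U' t - q.[t]), (fun t => V' t - q.[t]).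
  split; [exact: major|exact: minor|].
  by have := LP_gap_le _ _ _ _ _ _ xab HU' HV'; lra.
exists K; split=> //; have := KUV _ _ (major _ HU) (minor _ HV) => /andP[VK KU].
have := LP_gap_le _ _ _ _ _ _ xab HU HV.
have := Hq x xab; have := Hq a; rewrite lexx ltW// => /(_ isT).
by rewrite !ler_norml => /andP[? ?] /andP[? ?] ?; apply/andP; split; lra.
Qed.
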